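(* Let $\mathbf{m}=(m_1,\dots,m_n)$ be a nonzero sequence of nonnegative integers with $m_n=0$, let $p=\max\{j\in\{1,\dots,n\}:m_j\neq0\}$, let $\Delta=\mathfrak{I}(\mathbf{m})$ be the corresponding intersection complex, and let $\beta=\beta(I_{\Delta^*})$ be the Betti diagram of the Stanley-Reisner ideal of the Alexander dual of $\Delta$. Suppose $\beta$ has nonzero Betti numbers $\beta_{0,c_0},\dots,\beta_{p,c_p}$. Then $$\beta_{i,c_i}=\begin{cases}\binom{n}{i+1}&\text{if }0\le i\le p-1,\\[2pt] \binom{n-1}{p}&\text{if }i=p.\end{cases}$$
   Context: Write $[n]=\{1,\dots,n\}$. Intersection complexes: for a sequence $\mathbf{m}=(m_1,\dots,m_n)$ of nonnegative integers, $\mathfrak{I}(\mathbf{m})$ is the simplicial complex whose vertices are the symbols $v_S^r$ where $S$ is a nonempty subset of $[n]$ and $1\le r\le m_{|S|}$, and which is generated by the sets $F_1,\dots,F_n$, where $F_j=\{v_S^r : S\subseteq[n],\ j\in S,\ 1\le r\le m_{|S|}\}$ (i.e. its faces are all subsets of the $F_j$). The Alexander dual of a simplicial complex $\Delta$ on vertex set $V$ is $\Delta^*=\{F\subseteq V: V\setminus F\notin\Delta\}$. Over an arbitrary fixed field $\mathbb{K}$, the Stanley-Reisner ideal $I_\Gamma$ of a complex $\Gamma$ on vertex set $V$ is the ideal of the polynomial ring $R=\mathbb{K}[x_v:v\in V]$ generated by the monomials $\prod_{v\in F}x_v$ with $F\subseteq V$, $F\notin\Gamma$. The graded Betti numbers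 $\beta_{i,j}$ of a graded $R$-module $M$ are defined by its graded minimal free resolution $\cdots\to F_1\to F_0\to M\to0$ with $F_i=\bigoplus_jR(-j)^{\beta_{i,j}}$; here $M=I_{\Delta^*}$ (the ideal itself, not the quotient). The Betti diagram of $I_{\Delta^*}$ is pure, i.e. for each $0\le i\le p$ there is exactly one $c_i$ with $\beta_{i,c_i}\ne0$, and all other Betti numbers vanish. *)

(* Defs.v *)
From mathcomp Require Import all_boot all_order all_algebra.
From mathcomp Require Import mpoly.

Set Implicit Arguments.
Unset Strict Implicit.
Unset Printing Implicit Defensive.

Import GRing.Theory.
Local Open Scope ring_scope.

Definition alexander_dual (V : finType) (Delta : {set {set V}}) :
  {set {set V}} := [set F : {set V} | ~: F \notin Delta].

(* K[x_v : v in V] is {mpoly K[#|V|]}, with x_v encoded as 'X_(enum_rank v) *)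
Definition face_monomial (K : fieldType) (V : finType) (F : {set V}) :
  {mpoly K[#|V|]} := \prod_(v in F) 'X_(enum_rank v).

Definition SR_ideal (K : fieldType) (V : finType) (Gamma : {set {set V}})
    (f : {mpoly K[#|V|]}) : Prop :=
  exists a : {set V} -> {mpoly K[#|V|]},
    f = \sum_(F : {set V} | F \notin Gamma) a F * face_monomial K F.

(* F_i is free with basis indexed by ['I_(fc_rank i)], the k-th basis element
   being in degree [fc_deg i k], i.e. F_i is the direct sum of the
   R(- fc_deg i k).  Elements of F_i are row vectors, so the maps
   F_(i+1) -> F_i and F_0 -> R act by right multiplication. *)
Record free_complex (K : fieldType) (N : nat) := FreeComplex {
  fc_rank : nat -> nat;
  fc_deg  : forall i : nat, 'I_(fc_rank i) -> nat;
  fc_diff : forall i : nat, 'M[{mpoly K[N]}]_(fc_rank i.+1, fc_rank i);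
  fc_aug  : 'cV[{mpoly K[N]}]_(fc_rank 0) }.

Record minimal_graded_free_resolution (K : fieldType) (N : nat)
    (I : {mpoly K[N]} -> Prop) (C : free_complex K N) : Prop := {
  (* the maps are homogeneous of degree 0 *)
  mgfr_aug_homog : forall (k : 'I_(fc_rank C 0)) (u : 'X_{1..N}),
    u \in msupp (fc_aug C k ord0) -> mdeg u = fc_deg k;
  mgfr_diff_homog : forall (i : nat) (k : 'I_(fc_rank C i.+1))
      (l : 'I_(fc_rank C i)) (u : 'X_{1..N}),
    u \in msupp (fc_diff C i k l) -> (mdeg u + fc_deg l = fc_deg k)%N;
  (* ... -> F_1 -> F_0 -> I -> 0 is exact *)
  mgfr_exact_aug : forall f : {mpoly K[N]},
    I f <-> exists v : 'rV_(fc_rank C 0), v *m fc_aug C = f%:M;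
  mgfr_exact0 : forall v : 'rV_(fc_rank C 0),
    v *m fc_aug C = 0 <-> exists w : 'rV_(fc_rank C 1), v = w *m fc_diff C 0;
  mgfr_exactS : forall (i : nat) (v : 'rV_(fc_rank C i.+1)),
    v *m fc_diff C i = 0 <->
    exists w : 'rV_(fc_rank C i.+2), v = w *m fc_diff C i.+1;
  (* F_(i+1) is mapped into (x_1, ..., x_N) F_i *)
  mgfr_minimal : forall (i : nat) (k : 'I_(fc_rank C i.+1))
      (l : 'I_(fc_rank C i)),
    (fc_diff C i k l)@_0%MM = 0 }.

Definition betti_diagram (K : fieldType) (N : nat) (I : {mpoly K[N]} -> Prop)
    (beta : nat -> nat -> nat) : Prop :=
  exists2 C : free_complex K N, minimal_graded_free_resolution I C &
    forall i j : nat, beta i j = #|[set k : 'I_(fc_rank C i) | fc_deg k == j]|.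

(* m_j, with m = (m_1, ..., m_n) indexed from 1 *)
Definition entry (n : nat) (m : n.-tuple nat) (j : nat) : nat :=
  nth 0%N (0%N :: m) j.

Definition nonempty_subset (n : nat) := {S : {set 'I_n} | S != set0}.

(* the vertex v_S^(r+1) is [Tagged _ r] over S, with r : 'I_(m_|S|);
   [n] is encoded as 'I_n *)
Definition vertex (n : nat) (m : n.-tuple nat) : finType :=
  {S : nonempty_subset n & 'I_(entry m #|val S|)}.

Definition facet (n : nat) (m : n.-tuple nat) (j : 'I_n) : {set vertex m} :=
  [set v : vertex m | j \in val (tag v)].

Definition intersection_complex (n : nat) (m : n.-tuple nat) :
  {set {set vertex m}} :=
  [set A : {set vertex m} | [exists j : 'I_n, A \subset facet m j]].

(* Main.v *)
(* For a set sigma of indices let g_sigma be the lcm of the generators g_j of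
   I_{Delta^*}, where g_j is the product of the vertices outside F_j.  A vertex
   v_S^r divides g_sigma iff sigma is not contained in S, so g_sigma grows
   strictly with sigma as long as |sigma| <= p, all g_sigma with |sigma| > p
   coincide, and deg g_sigma depends on |sigma| only.  The Taylor complex, with
   basis e_sigma, is exact because in each multidegree it is the chain complex
   of a simplex.  Keep the e_sigma with |sigma| <= p and, for |sigma| = p+1,
   those where sigma contains a fixed index z: the boundaries of the dropped
   e_sigma with |sigma| = p+1 are combinations of the boundaries of the kept
   ones, so the complex remains exact, and it becomes minimal.  By the
   uniqueness of graded ranks in minimal resolutions, it remains to count. *)
Require Import Defs.
From mathcomp Require Import all_boot all_order all_algebra.
From mathcomp Require Import mpoly.

Set Implicit Arguments.
Unset Strict Implicit.
Unset Printing Implicit Defensive.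

Import GRing.Theory.
Local Open Scope ring_scope.

(** * Graded matrices over the polynomial ring *)

Section Homogeneous.

Variables (K : fieldType) (N : nat).

(** Matrices act on row vectors from the right, so M is a degree-0 map from the sum of the R(-a k)
    to the sum of the R(-b l). Only supports are constrained, so zero entries fit every degree. *)
Definition homogeneous_mx r s (a : 'I_r -> nat) (b : 'I_s -> nat)
    (M : 'M[{mpoly K[N]}]_(r, s)) : Prop :=
  forall k l u, u \in msupp (M k l) -> (mdeg u + b l = a k)%N.

Lemma homogeneous_mxM q r s a b c (M : 'M_(q, r)) (M' : 'M_(r, s)) :
  homogeneous_mx a b M -> homogeneous_mx b c M' ->
  homogeneous_mx a c (M *m M').
Proof.
move=> hM hM' k l u; rewrite mcoeff_msupp mxE raddf_sum /= => nz.
have [j nzj | z] := pickP (fun j => (M k j * M' j l)@_u != 0); last first.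
  by case/eqP: nz; apply: big1 => j _; apply/eqP; have /negbFE := z j.
move: nzj; rewrite -mcoeff_msupp => /msuppM_le /allpairsP[[u1 u2] /=].
case=> h1 h2 ->.
by rewrite mdegD -addnA (hM' _ _ _ h2) (hM _ _ _ h1).
Qed.

Lemma mcoeff_pihomog d (f : {mpoly K[N]}) u :
  (pihomog mdeg d f)@_u = if mdeg u == d then f@_u else 0.
Proof.
pose B := maxn (msize f) (mdeg u).+1.
rewrite (@pihomogwE _ _ mdeg d B) ?leq_maxl // big_mkcond /=.
rewrite (eq_bigr (fun m : 'X_{1..N < B} =>
    (if mdeg m == d then f@_m else 0) *: 'X_[m])); last first.
  by move=> m _; case: ifP; rewrite ?scale0r.
by rewrite (mcoeff_mpoly (fun m => if mdeg m == d then f@_m else 0))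
  // leq_maxr.
Qed.

(** Rowwise solutions need not be homogeneous. Since D is, keeping only the component of degree a k
    - b l in each entry still gives a solution. *)
Lemma homogeneous_factor q r s a b c (M : 'M_(q, s)) (D : 'M_(r, s)) :
  homogeneous_mx a c M -> homogeneous_mx b c D ->
  (forall i, exists w : 'rV_r, row i M = w *m D) ->
  exists2 W, homogeneous_mx a b W & M = W *m D.
Proof.
move=> hM hD /fin_all_exists[w wP].
(* The test guards against truncated subtraction, which would keep constant terms when b l exceeds a
   k. *)
pose W : 'M_(q, r) := \matrix_(k, l)
  if (b l <= a k)%N then pihomog mdeg (a k - b l)%N (w k 0 l) else 0.
have hW : homogeneous_mx a b W.
  move=> k l u; rewrite mxE mcoeff_msupp; case: leqP => [le|_]; last first.
    by rewrite mcoeff0 eqxx.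
  rewrite mcoeff_pihomog; case: (mdeg u =P _) => [->|]; first by rewrite subnK.
  by rewrite eqxx.
exists W => //; apply/matrixP => k t; apply/mpolyP => u.
have [du|du] := eqVneq (mdeg u + c t)%N (a k); last first.
  have /eqP -> : (M k t)@_u == 0.
    by apply: contraNT du; rewrite -mcoeff_msupp => /hM ->.
  apply/esym/eqP; apply: contraNT du; rewrite -mcoeff_msupp => h; apply/eqP.
  exact: (homogeneous_mxM hW hD) h.
have -> : M k t = \sum_l w k 0 l * D l t.
  by have /rowP/(_ t) := wP k; rewrite !mxE.
rewrite mxE !raddf_sum; apply: eq_bigr => l _ /=; rewrite !mcoeffM.
apply: eq_bigr => v /eqP uv; have [->|nz] := eqVneq (D l t)@_v.2 0.
  by rewrite !mulr0.
congr (_ * _); move: nz; rewrite -mcoeff_msupp => /hD dv.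
have dw : (mdeg v.1 + b l = a k)%N.
  by rewrite -dv -du [in RHS](congr1 mdeg uv) mdegD addnA.
by rewrite mxE -dw leq_addl mcoeff_pihomog addnK eqxx.
Qed.

End Homogeneous.

(** P respects degrees, so its degree-j block is itself right invertible, and a right invertible
    matrix has no more rows than columns. *)
Lemma leq_card_graded_mulmx1 (K : fieldType) r s (a : 'I_r -> nat)
    (b : 'I_s -> nat) (P : 'M[K]_(r, s)) (Q : 'M_(s, r)) j :
  (forall k l, P k l != 0 -> a k = b l) -> P *m Q = 1%:M ->
  (#|[set k | a k == j]| <= #|[set l | b l == j]|)%N.
Proof.
move=> hP PQ; set A := [set k | _]; set B := [set l | _].
apply: (@mulmx1_min _ _ _ (mxsub (enum_val (A := A)) (enum_val (A := B)) P)
                        (mxsub (enum_val (A := B)) (enum_val (A := A)) Q)).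
apply/matrixP => k k'; rewrite !mxE.
have /matrixP/(_ (enum_val k) (enum_val k')) := PQ; rewrite !mxE.
rewrite (inj_eq enum_val_inj) => <-.
rewrite [RHS](bigID (mem B)) /= [X in _ + X]big1 ?addr0.
  by rewrite [RHS]big_enum_val; apply: eq_bigr => l _; rewrite !mxE.
move=> l; rewrite inE => /negP bl.
have [->|/hP al] := eqVneq (P (enum_val k) l) 0.
  by rewrite mul0r.
by case: bl; rewrite -al; have := enum_valP k; rewrite inE.
Qed.

(** * Uniqueness of graded ranks in minimal resolutions *)

Section Comparison.

Variables (K : fieldType) (N : nat).
Implicit Types C D : free_complex K N.

Definition mx_at0 r s (M : 'M[{mpoly K[N]}]_(r, s)) : 'M[K]_(r, s) :=
  map_mx (mcoeff 0%MM) M.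

(** Two consecutive components of a chain map: the induction on i never needs more of the map than
    one square. *)
Definition chain_square C D i (f : 'M_(fc_rank C i, fc_rank D i))
    (f' : 'M_(fc_rank C i.+1, fc_rank D i.+1)) : Prop :=
  [/\ homogeneous_mx (@fc_deg K N C i) (@fc_deg K N D i) f,
      homogeneous_mx (@fc_deg K N C i.+1) (@fc_deg K N D i.+1) f' &
      fc_diff C i *m f = f' *m fc_diff D i].

(* What an endomorphism [1 + d h_(i-1) + h_i d] of C_i, for a homotopy h,
   retains once h_(i-1) is forgotten. *)
Definition homotopic1 C i (f : 'M_(fc_rank C i)) : Prop :=
  mx_at0 f = 1%:M /\
  exists h, fc_diff C i *m f = fc_diff C i + fc_diff C i *m h *m fc_diff C i.

Section Resolution.

Variables (I : {mpoly K[N]} -> Prop) (C : free_complex K N).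
Hypothesis resC : minimal_graded_free_resolution I C.

Lemma mx_at0_diff i : mx_at0 (fc_diff C i) = 0.
Proof. by apply/matrixP => k l; rewrite !mxE (mgfr_minimal resC). Qed.

Lemma diff_aug : fc_diff C 0 *m fc_aug C = 0.
Proof.
apply/row_matrixP => k; rewrite row_mul row0; apply/(mgfr_exact0 resC).
by exists (delta_mx 0 k); rewrite rowE.
Qed.

Lemma diff_diff i : fc_diff C i.+1 *m fc_diff C i = 0.
Proof.
apply/row_matrixP => k; rewrite row_mul row0; apply/(mgfr_exactS resC).
by exists (delta_mx 0 k); rewrite rowE.
Qed.

Lemma factor_aug q a (M : 'cV_q) :
    homogeneous_mx a (fun _ => 0%N) M -> (forall k, I (M k 0)) ->
  exists2 W, homogeneous_mx a (@fc_deg K N C 0) W & M = W *m fc_aug C.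
Proof.
move=> hM IM; apply: homogeneous_factor hM _ _.
  by move=> k l u; rewrite (ord1 l) addn0; apply: (mgfr_aug_homog resC).
move=> k; have /(mgfr_exact_aug resC)[w wP] := IM k; exists w; rewrite wP.
by apply/rowP => l; rewrite !mxE (ord1 l).
Qed.

Lemma factor_diff0 q a (M : 'M_(q, _)) :
    homogeneous_mx a (@fc_deg K N C 0) M -> M *m fc_aug C = 0 ->
  exists2 W, homogeneous_mx a (@fc_deg K N C 1) W & M = W *m fc_diff C 0.
Proof.
move=> hM M0; apply: homogeneous_factor hM (@mgfr_diff_homog _ _ _ _ resC 0) _.
by move=> k; apply/(mgfr_exact0 resC); rewrite -row_mul M0 row0.
Qed.

Lemma factor_diffS i q a (M : 'M_(q, _)) :
    homogeneous_mx a (@fc_deg K N C i.+1) M -> M *m fc_diff C i = 0 ->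
  exists2 W, homogeneous_mx a (@fc_deg K N C i.+2) W & M = W *m fc_diff C i.+1.
Proof.
move=> hM M0; apply: homogeneous_factor hM (@mgfr_diff_homog _ _ _ _ resC _) _.
by move=> k; apply/(mgfr_exactS resC); rewrite -row_mul M0 row0.
Qed.

Lemma exact_diff0 q (M : 'M_(q, _)) :
  M *m fc_aug C = 0 -> exists W, M = W *m fc_diff C 0.
Proof.
move=> M0; have h k : exists w, row k M = w *m fc_diff C 0.
  by apply/(mgfr_exact0 resC); rewrite -row_mul M0 row0.
have [w wP] := fin_all_exists h; exists (\matrix_k w k).
by apply/row_matrixP => k; rewrite row_mul rowK wP.
Qed.

Lemma exact_diffS i q (M : 'M_(q, _)) :
  M *m fc_diff C i = 0 -> exists W, M = W *m fc_diff C i.+1.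
Proof.
move=> M0; have h k : exists w, row k M = w *m fc_diff C i.+1.
  by apply/(mgfr_exactS resC); rewrite -row_mul M0 row0.
have [w wP] := fin_all_exists h; exists (\matrix_k w k).
by apply/row_matrixP => k; rewrite row_mul rowK wP.
Qed.

Lemma homotopic1_diff i (f : 'M_(fc_rank C i)) h :
  f - 1%:M = h *m fc_diff C i -> homotopic1 f.
Proof.
move=> fh; have -> : f = 1%:M + h *m fc_diff C i by rewrite -fh addrC subrK.
split; last by exists h; rewrite mulmxDr mulmx1 mulmxA.
rewrite /mx_at0 map_mxD map_mxM map_mx1 [map_mx _ (fc_diff C i)]mx_at0_diff.
by rewrite mulmx0 addr0.
Qed.

(** Commutation shows that f' - 1 - d h is killed by d, so exactness yields f' = 1 + d h + h' d.
    Minimality makes both corrections vanish at 0, and d d = 0 removes the term d h after composing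
    with d. *)
Lemma homotopic1S i (f : 'M_(fc_rank C i)) (f' : 'M_(fc_rank C i.+1)) :
  fc_diff C i *m f = f' *m fc_diff C i -> homotopic1 f -> homotopic1 f'.
Proof.
move=> sq [_ [h fh]].
have /exact_diffS[h'] : (f' - 1%:M - fc_diff C i *m h) *m fc_diff C i = 0.
  by rewrite !mulmxBl mul1mx -sq fh [fc_diff C i + _]addrC addrK subrr.
move/(canRL (subrK _))/(canRL (subrK _)) => ->; split.
  rewrite /mx_at0 !map_mxD !map_mxM map_mx1.
  rewrite ![map_mx _ (fc_diff C _)]mx_at0_diff.
  by rewrite mulmx0 mul0mx !add0r.
by exists h'; rewrite !mulmxDr mulmx1 !mulmxA diff_diff mul0mx addr0 addrC.
Qed.

End Resolution.

Lemma chain_squareS I C D i (f : 'M_(fc_rank C i, fc_rank D i)) f' :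
    minimal_graded_free_resolution I C -> minimal_graded_free_resolution I D ->
  chain_square f f' -> exists f'', chain_square f' f''.
Proof.
move=> resC resD [hf hf' sq].
have [] := @factor_diffS I D resD i _ (@fc_deg K N C i.+2)
                        (fc_diff C i.+1 *m f').
- exact: homogeneous_mxM (@mgfr_diff_homog _ _ _ _ resC _) hf'.
- by rewrite -mulmxA -sq mulmxA (diff_diff resC) mul0mx.
by move=> f'' hf'' sq'; exists f''.
Qed.

Lemma chain_square0 I C D :
    minimal_graded_free_resolution I C -> minimal_graded_free_resolution I D ->
  exists (f : 'M_(fc_rank C 0, fc_rank D 0)) f',
    chain_square f f' /\ f *m fc_aug D = fc_aug C.
Proof.
move=> resC resD.
have [|k|f hf af] := factor_aug resD (a := @fc_deg K N C 0) (M := fc_aug C).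
- by move=> k l u; rewrite (ord1 l) addn0; apply: (mgfr_aug_homog resC).
- apply/(mgfr_exact_aug resC); exists (delta_mx 0 k).
  by rewrite -rowE; apply/rowP => l; rewrite !mxE (ord1 l).
have [||f' hf' sq] :=
    factor_diff0 resD (a := @fc_deg K N C 1) (M := fc_diff C 0 *m f).
- exact: homogeneous_mxM (@mgfr_diff_homog _ _ _ _ resC 0) hf.
- by rewrite -mulmxA -af (diff_aug resC).
by exists f, f'.
Qed.

Lemma resolution_comparison I C D i :
    minimal_graded_free_resolution I C -> minimal_graded_free_resolution I D ->
  exists (f : 'M_(fc_rank C i, fc_rank D i)) f' g g',
    [/\ chain_square f f', chain_square g g', homotopic1 (f *m g) &
        homotopic1 (g *m f)].
Proof.
(* The squares are part of the induction statement: f' and g' are the next maps, and the commuting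
   squares transport homotopy to the identity from f g to f' g'. *)
move=> resC resD; elim: i => [|i [f [f' [g [g' [cf cg hfg hgf]]]]]].
  have [f [f' [cf af]]] := chain_square0 resC resD.
  have [g [g' [cg ag]]] := chain_square0 resD resC.
  exists f, f', g, g'; split=> //.
    have [|h] := exact_diff0 resC (M := f *m g - 1%:M).
      by rewrite mulmxBl mul1mx -mulmxA ag af subrr.
    by move/(homotopic1_diff resC).
  have [|h] := exact_diff0 resD (M := g *m f - 1%:M).
    by rewrite mulmxBl mul1mx -mulmxA af ag subrr.
  by move/(homotopic1_diff resD).
have [f'' cf'] := chain_squareS resC resD cf.
have [g'' cg'] := chain_squareS resD resC cg.
have [_ _ sqf] := cf; have [_ _ sqg] := cg.
exists f', f'', g', g''; split=> //.
  by apply: (homotopic1S resC) hfg; rewrite mulmxA sqf -!mulmxA sqg.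
by apply: (homotopic1S resD) hgf; rewrite mulmxA sqg -!mulmxA sqf.
Qed.

(** At 0, f has right inverse g, and a nonzero constant term of a homogeneous entry forces equal
    degrees. *)
Lemma leq_card_deg C D i j (f : 'M_(fc_rank C i, fc_rank D i)) f' g :
    chain_square f f' -> homotopic1 (f *m g) ->
  (#|[set k : 'I_(fc_rank C i) | fc_deg k == j]|
    <= #|[set k : 'I_(fc_rank D i) | fc_deg k == j]|)%N.
Proof.
move=> [hf _ _] [fg1 _].
apply: (@leq_card_graded_mulmx1 _ _ _ _ _ (mx_at0 f) (mx_at0 g)).
  by move=> k l; rewrite mxE -mcoeff_msupp => /hf; rewrite mdeg0.
by rewrite -map_mxM.
Qed.

Lemma betti_unique I C D i j :
    minimal_graded_free_resolution I C -> minimal_graded_free_resolution I D ->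
  #|[set k : 'I_(fc_rank C i) | fc_deg k == j]|
    = #|[set k : 'I_(fc_rank D i) | fc_deg k == j]|.
Proof.
move=> resC resD.
have [f [f' [g [g' [cf cg hfg hgf]]]]] := resolution_comparison i resC resD.
by apply/eqP; rewrite eqn_leq (leq_card_deg j cf hfg) (leq_card_deg j cg hgf).
Qed.

End Comparison.

(** * Simplicial boundaries with coefficients, and cones *)

Section WeightedBoundary.

Variables (n : nat) (R : comNzRingType).
Implicit Types (rho sigma tau : {set 'I_n}) (j l z : 'I_n).

Definition sgn j tau : R := (-1) ^+ #|[set k in tau | (k < j)%N]|.

Lemma sgnK j tau : sgn j tau * sgn j tau = 1.
Proof. by rewrite -expr2 sqrr_sign. Qed.

Lemma sgn_setU1 j l tau :
  l \notin tau -> sgn j (l |: tau) = (-1) ^+ (l < j)%N * sgn j tau.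
Proof.
move=> ltau; rewrite /sgn -exprD; congr (_ ^+ _).
rewrite (cardD1 l) !inE eqxx /=; congr (_ + _)%N; apply: eq_card => k.
by rewrite !inE; case: eqVneq => // ->; rewrite (negPf ltau).
Qed.

Lemma sgn_swap j l rho : j != l -> j \notin rho -> l \notin rho ->
  sgn j (l |: rho) * sgn l (j |: rho) = - (sgn j rho * sgn l rho).
Proof.
move=> jl jr lr; rewrite !sgn_setU1 // mulrACA -[RHS]mulN1r; congr (_ * _).
by move: jl; rewrite -val_eqE /=; case: ltngtP => //= _ _;
  rewrite ?mulr1 ?mul1r.
Qed.

(** A chain is the function of its coefficients. The boundary is read off at tau, collecting what
    each face map from j |: tau to tau contributes with weight c j tau. *)
Definition bd (c : 'I_n -> {set 'I_n} -> R) (u : {set 'I_n} -> R) tau : R :=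
  \sum_(j | j \notin tau) sgn j tau * c j tau * u (j |: tau).

Definition cone z (u : {set 'I_n} -> R) sigma : R :=
  if z \in sigma then sgn z (sigma :\ z) * u (sigma :\ z) else 0.

Lemma eq_bd c u u' : u =1 u' -> bd c u =1 bd c u'.
Proof. by move=> uu tau; apply: eq_bigr => j _; rewrite uu. Qed.

Lemma bdB c u u' tau : bd c (fun sigma => u sigma - u' sigma) tau
  = bd c u tau - bd c u' tau.
Proof. by rewrite /bd -sumrB; apply: eq_bigr => j _; rewrite mulrBr. Qed.

(** The hypothesis says that the weight of adding j and l is independent of the order, so the two
    orders cancel by sign. *)
Lemma bd_bd c u tau :
    (forall j l, c j tau * c l (j |: tau) = c l tau * c j (l |: tau)) ->
  bd c (bd c u) tau = 0.
Proof.
move=> csym; pose F j l :=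
  sgn j tau * sgn l (j |: tau) * (c j tau * c l (j |: tau))
    * u (l |: (j |: tau)).
have Fanti j l : j \notin tau -> l \notin tau -> j != l -> F j l = - F l j.
  move=> jt lt jl; rewrite /F csym setUCA -!mulNr; congr (_ * _ * _).
  rewrite !sgn_setU1 // mulNr [LHS]mulrCA [X in _ = - X]mulrCA.
  rewrite [sgn l tau * _]mulrC -mulNr.
  congr (_ * _); move: jl; rewrite -val_eqE /=.
  by case: ltngtP => //= _ _; rewrite opprK.
have -> : bd c (bd c u) tau =
    \sum_(j | j \notin tau) \sum_(l | (l \notin tau) && (l != j)) F j l.
  apply: eq_bigr => j jt; rewrite /bd mulr_sumr; apply: eq_big => [l|l _].
    by rewrite !inE negb_or andbC.
  by rewrite /F !mulrA; congr (_ * _); rewrite -!mulrA; congr (_ * _);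
    rewrite mulrCA.
(* Splitting by l < j and exchanging the sums in one half matches each F j l with F l j. *)
under eq_bigr => j jt do rewrite (bigID (fun l : 'I_n => (l < j)%N)) /=.
rewrite big_split /= addrC [X in _ + X](exchange_big_dep
  (fun l => l \notin tau)) /=.
  rewrite -big_split big1 //= => j jt; rewrite [X in _ + X](eq_bigl
    (fun l => (l \notin tau) && (l != j) && ~~ (l < j)%N)); last first.
    move=> l; rewrite jt /= -!val_eqE /=.
    by case: (l \notin tau) => //=; case: ltngtP.
  rewrite -big_split big1 //= => l /andP[/andP[lt lj] _].
  by rewrite Fanti ?addNr // eq_sym.
by move=> i j _ /andP[/andP[]].
Qed.

Lemma bd_cone_notin c z u tau :
  z \notin tau -> bd c (cone z u) tau = c z tau * u tau.
Proof.
move=> zt; rewrite /bd (bigD1 z) //= big1 ?addr0 => [|j /andP[jt jz]].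
  by rewrite /cone setU11 setU1K // mulrACA sgnK mul1r.
by rewrite /cone !inE eq_sym (negPf jz) (negPf zt) mulr0.
Qed.

Lemma bd_cone z u : bd (fun _ _ => 1) u =1 (fun _ => 0) ->
  bd (fun _ _ => 1) (cone z u) =1 u.
Proof.
move=> u0 tau; have [zt|zt] := boolP (z \in tau); last first.
  by rewrite bd_cone_notin // mul1r.
pose rho := tau :\ z; have zr : z \notin rho by rewrite !inE eqxx.
have tauE : z |: rho = tau by rewrite setD1K.
(* The cycle condition at tau without z expresses u tau through the sets j |: rho; up to sign these
   are the terms of the boundary of the cone at tau. *)
have := u0 rho; rewrite /bd (bigD1 z) //= tauE mulr1.
move/(canRL (addrK _)); rewrite add0r => ur.
transitivity (- sgn z rho * - (sgn z rho * u tau)).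
  rewrite ur opprK mulr_sumr; apply: eq_big => [j|j jt].
    by rewrite !inE negb_and negbK; case: eqVneq => [->|]; rewrite ?zt ?andbT.
  have jz : j != z by apply: contraNneq jt => ->.
  have jr : j \notin rho by rewrite !inE jz.
  rewrite /cone !inE zt orbT !mulr1.
  have -> : (j |: tau) :\ z = j |: rho.
    by rewrite -tauE setUCA setU1K // !inE negb_or [z == j]eq_sym jz eqxx.
  by rewrite -tauE !mulrA sgn_swap // !mulNr [sgn j rho * _]mulrC.
by rewrite mulrNN mulrA sgnK mul1r.
Qed.

End WeightedBoundary.

Arguments sgn {n R}.

(** * The Taylor complex and its exactness *)

Section Taylor.

Variables (K : fieldType) (n N : nat) (g : 'I_n -> 'X_{1..N}).
Local Notation R := {mpoly K[N]}.
Implicit Types (sigma tau : {set 'I_n}) (j z : 'I_n) (a b : 'X_{1..N}).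
Implicit Types u w : {set 'I_n} -> R.

Definition lcm_exp sigma : 'X_{1..N} :=
  [multinom \max_(j in sigma) g j i | i < N].

Lemma lcm_expP sigma a :
  reflect (forall j, j \in sigma -> (g j <= a)%MM) (lcm_exp sigma <= a)%MM.
Proof.
apply: (iffP mnm_lepP) => [h j js|h i].
  apply/mnm_lepP => i; apply: leq_trans (h i); rewrite mnmE.
  exact: (@leq_bigmax_cond _ _ (fun l => g l i)).
by rewrite mnmE; apply/bigmax_leqP => j /h /mnm_lepP.
Qed.

Lemma lcm_exp_subset sigma tau :
  sigma \subset tau -> (lcm_exp sigma <= lcm_exp tau)%MM.
Proof.
move=> st; apply/lcm_expP => j js; move: (lepm_refl (lcm_exp tau)).
by move/lcm_expP; apply; apply: subsetP js.
Qed.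

Lemma lcm_exp0 : lcm_exp set0 = 0%MM.
Proof. by apply/mnmP => i; rewrite !mnmE big_set0. Qed.

Lemma lcm_exp1 j : lcm_exp [set j] = g j.
Proof. by apply/mnmP => i; rewrite !mnmE big_set1. Qed.

Lemma lcm_expU1 j tau a :
  (lcm_exp (j |: tau) <= a)%MM = (g j <= a)%MM && (lcm_exp tau <= a)%MM.
Proof.
apply/lcm_expP/andP => [h|[hj /lcm_expP h] l].
  split; first by apply: h; rewrite setU11.
  by apply/lcm_expP => l lt; apply: h; rewrite !inE lt orbT.
by rewrite !inE => /orP[/eqP->|/h].
Qed.

Definition taylor_weight j tau : R := 'X_[lcm_exp (j |: tau) - lcm_exp tau].

Definition taylor u : {set 'I_n} -> R := bd taylor_weight u.

Lemma eq_taylor u w : u =1 w -> taylor u =1 taylor w.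
Proof. exact: eq_bd. Qed.

Lemma taylorB u w tau :
  taylor (fun sigma => u sigma - w sigma) tau = taylor u tau - taylor w tau.
Proof. exact: bdB. Qed.

(** Lcm quotients telescope: in either order, adding j and l to tau contributes the lcm of the
    enlarged set divided by that of tau. *)
Lemma taylor_taylor u tau : taylor (taylor u) tau = 0.
Proof.
apply: bd_bd => j l; rewrite /taylor_weight -!mpolyXD.
congr 'X_[_]; apply/mnmP => i; rewrite !mnmDE !mnmBE.
have le1 j' t : (lcm_exp t i <= lcm_exp (j' |: t) i)%N.
  by have /mnm_lepP/(_ i) := lcm_exp_subset (subsetU1 j' t).
rewrite addnC addnBA // subnK // [RHS]addnC addnBA // subnK //.
by rewrite setUCA.
Qed.

Lemma mcoeff_sgnM j tau (f : R) a : (sgn j tau * f)@_a = sgn j tau * f@_a.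
Proof.
rewrite /sgn -![(-1) ^+ #|_|]signr_odd; case: odd.
  by rewrite !expr1 !mulN1r mcoeffN.
by rewrite !expr0 !mul1r.
Qed.

Lemma mcoeffXM b (f : R) a :
  ('X_[b] * f)@_a = if (b <= a)%MM then f@_(a - b) else 0.
Proof.
rewrite -commr_mpolyX; case: ifP => [le|nle].
  by rewrite -{1}(submK le) addmC mcoeffMX.
apply/eqP; rewrite mcoeff_eq0 (perm_mem (msuppMX _ _)).
by apply/mapP => -[m _ am]; rewrite am lem_addr in nle.
Qed.

(* The part of u in multidegree a, where the basis element sigma has
   multidegree [lcm_exp sigma]. *)
Definition graded_part a u sigma : K :=
  if (lcm_exp sigma <= a)%MM then (u sigma)@_(a - lcm_exp sigma) else 0.

(** Multiplication by a lcm quotient exactly offsets the change of [lcm_exp], so in a fixed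
    multidegree all weights become 1. *)
Lemma graded_part_taylor a u :
  graded_part a (taylor u) =1 bd (fun _ _ => 1) (graded_part a u).
Proof.
move=> tau; rewrite /graded_part /bd; case: ifPn => [ta|nta]; last first.
  rewrite big1 // => j _; rewrite lcm_expU1 (negPf nta) andbF mulr0 //.
rewrite raddf_sum; apply: eq_bigr => j _ /=.
rewrite -mulrA mcoeff_sgnM mulr1 mcoeffXM; congr (_ * _).
have le := lcm_exp_subset (subsetU1 j tau).
have -> : (lcm_exp (j |: tau) - lcm_exp tau <= a - lcm_exp tau)%MM
          = (lcm_exp (j |: tau) <= a)%MM.
  apply/mnm_lepP/mnm_lepP => h i; have := h i; rewrite !mnmBE;
    last exact: leq_sub2r.
  by rewrite leq_subLR subnKC //; move/mnm_lepP: ta.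
case: ifP => // _; congr (_@_ _); apply/mnmP => i;
  rewrite !mnmBE subnBA ?subnK //.
  by move/mnm_lepP: ta.
by move/mnm_lepP: le.
Qed.

Lemma mpoly_of_coeffs B (E : 'X_{1..N} -> K) :
  (forall a, (B <= mdeg a)%N -> E a = 0) -> exists f : R, forall a, f@_a = E a.
Proof.
move=> E0; exists (\sum_(m : 'X_{1..N < B}) (E m *: 'X_[m])) => a.
have [le|lt] := leqP B (mdeg a); last exact: mcoeff_mpoly.
rewrite E0 // raddf_sum big1 //= => m _; rewrite mcoeffZ mcoeffX.
by case: eqP => [ma|]; rewrite ?mulr0 //; have := bmdeg m; rewrite ma ltnNge le.
Qed.

Definition in_size k u : Prop := forall sigma, #|sigma| != k -> u sigma = 0.

Lemma cone_in_size k z u : in_size k u -> in_size k.+1 (cone z u).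
Proof.
move=> uk sigma; rewrite (cardsD1 z) /cone; case: ifP => // _.
by rewrite add1n eqSS => /uk ->; rewrite mulr0.
Qed.

Lemma taylor_in_size k u : in_size k.+1 u -> in_size k (taylor u).
Proof.
move=> uk tau tk; apply: big1 => j jt.
by rewrite uk ?mulr0 // cardsU1 jt add1n eqSS.
Qed.

(* In multidegree a the complex is the chain complex of the simplex on the j
   with g_j dividing x^a, hence is contracted by a cone. *)
Lemma taylor_exact k u : (0 < k)%N -> in_size k u -> taylor u =1 (fun _ => 0) ->
  exists2 w, in_size k.+1 w & taylor w =1 u.
Proof.
move=> k0 uk u0.
(* The apex z depends on the multidegree a alone, so that one cone contracts the whole part of u in
   multidegree a. *)
pose W a sigma := if [pick z | (g z <= a)%MM] is Some z
  then cone z (graded_part a u) sigma else 0.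
(* [B] leaves finitely many prescribed coefficients: the exponent read in u at [sigma :\ z] has
   degree at least that of a. *)
pose B := \max_tau msize (u tau).
have exW sigma : exists f : R, forall a, f@_a = W (a + lcm_exp sigma)%MM sigma.
  apply: (@mpoly_of_coeffs B) => a Ba; rewrite /W; case: pickP => // z _.
  rewrite /cone; case: ifP => // zs; rewrite /graded_part.
  case: ifP => [le|_]; last by rewrite mulr0.
  rewrite memN_msupp_eq0 ?mulr0 //; apply: contraL Ba.
  move/msize_mdeg_lt => lt; rewrite -ltnNge.
  apply: leq_trans (leq_bigmax (sigma :\ z)); apply: leq_ltn_trans lt.
  have {}le := lcm_exp_subset (subD1set sigma z).
  rewrite !mdegE; apply: leq_sum => i _;
    rewrite mnmBE mnmDE -addnBA ?leq_addr //.
  by move/mnm_lepP: le.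
have [w wP] := fin_all_exists exW; exists w.
  move=> sigma sk; apply/mpolyP => a; rewrite wP mcoeff0 /W;
    case: pickP => // z _.
  rewrite /cone; case: ifP => // zs; rewrite /graded_part uk ?mcoeff0.
    by rewrite if_same mulr0.
  by move: sk; rewrite (cardsD1 z) zs add1n eqSS.
move=> tau; apply/mpolyP => b; pose a := (b + lcm_exp tau)%MM.
have coefE v : (v tau)@_b = graded_part a v tau.
  by rewrite /graded_part lem_addl addmK.
have wE : graded_part a w =1 W a.
  move=> sigma; rewrite {1}/graded_part; case: ifP => [le|nle].
    by rewrite wP submK.
  rewrite /W; case: pickP => // z za; rewrite /cone; case: ifP => // zs.
  (* As g z divides a, the lcm of sigma divides a exactly when that of [sigma :\ z] does, so the
     cone also vanishes here. *)
  have := lcm_expU1 z (sigma :\ z) a; rewrite setD1K // nle za /= => /esym le.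
  by rewrite /graded_part le mulr0.
rewrite !coefE graded_part_taylor (eq_bd _ wE) /W; case: pickP => [z za|none].
  apply: bd_cone => rho; rewrite -graded_part_taylor /graded_part u0 mcoeff0.
  exact: if_same.
(* No generator divides x^a, so only the empty set could contribute, and u vanishes there because 0
   < k. *)
rewrite /bd big1 => [|j _]; last by rewrite mulr0.
have [->|[j jt]] := set_0Vmem tau.
  by rewrite /graded_part uk ?mcoeff0 ?if_same // cards0 eq_sym -lt0n.
have := none j; have /lcm_expP -> // := lem_addl b (lcm_exp tau).
Qed.

End Taylor.

Definition monomial_ideal (K : fieldType) n N (g : 'I_n -> 'X_{1..N})
    (f : {mpoly K[N]}) : Prop :=
  exists c : 'I_n -> {mpoly K[N]}, f = \sum_j c j * 'X_[g j].

(** * The truncated Taylor complex as a minimal resolution *)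

Section TruncatedTaylor.

Variables (K : fieldType) (n N p : nat) (z : 'I_n) (g : 'I_n -> 'X_{1..N}).
Local Notation R := {mpoly K[N]}.
Local Notation lcm_exp := (lcm_exp g).
Local Notation taylor := (@taylor K n N g).
Implicit Types (sigma tau : {set 'I_n}) (j : 'I_n) (u w : {set 'I_n} -> R).

(* All lcms of more than p generators agree, so the Taylor complex may be cut
   off at sets of size p.+1, where those containing z suffice. *)
Definition tbasis i : {set {set 'I_n}} :=
  [set sigma : {set 'I_n} | (#|sigma| == i.+1) &&
    ((i < p)%N || (i == p) && (z \in sigma))].

Definition in_tbasis i u : Prop :=
  forall sigma, sigma \notin tbasis i -> u sigma = 0.

(** At most one j qualifies, so this is a single incidence coefficient, or 0; the sum avoids
    choosing j. *)
Definition tcoef sigma tau : R :=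
  \sum_(j | (j \notin tau) && (j |: tau == sigma))
    sgn j tau * taylor_weight K g j tau.

Definition truncated_taylor : free_complex K N :=
  FreeComplex (fc_rank := fun i => #|tbasis i|)
    (fun i k => mdeg (lcm_exp (enum_val k)))
    (fun i => \matrix_(k, l) tcoef (enum_val k) (enum_val l))
    (\col_k 'X_[lcm_exp (enum_val k)]).

(** Extension by zero to all sets, which lets the truncated differential be computed by [taylor]. *)
Definition chain_of i (v : 'rV[R]_#|tbasis i|) sigma : R :=
  \sum_(k | enum_val k == sigma) v 0 k.

Lemma chain_of_in i v : in_tbasis i (@chain_of i v).
Proof.
move=> sigma st; apply: big1 => k /eqP ks.
by have := enum_valP k; rewrite ks (negPf st).
Qed.

Lemma chain_of_enum_val i v k : @chain_of i v (enum_val k) = v 0 k.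
Proof.
rewrite /chain_of (eq_bigl (pred1 k)) ?big_pred1_eq // => l /=.
by rewrite (inj_eq enum_val_inj).
Qed.

Lemma chain_of_row i u :
  in_tbasis i u -> @chain_of i (\row_k u (enum_val k)) =1 u.
Proof.
move=> ui sigma; have [si|si] := boolP (sigma \in tbasis i).
  by rewrite -(enum_rankK_in si si) chain_of_enum_val mxE.
by rewrite ui // (chain_of_in _ si).
Qed.

Lemma tcoef_sum (r : nat) (e : 'I_r -> {set 'I_n}) (v : 'rV_r) tau :
  \sum_k v 0 k * tcoef (e k) tau
    = taylor (fun sigma => \sum_(k | e k == sigma) v 0 k) tau.
Proof.
rewrite /taylor /bd; under eq_bigr => k _ do rewrite /tcoef mulr_sumr.
rewrite (exchange_big_dep (fun j => j \notin tau)) /=;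
  last by move=> k j _ /andP[].
apply: eq_bigr => j jt; rewrite mulr_sumr; apply: eq_big => [k|k _].
  by rewrite jt eq_sym.
by rewrite mulrC.
Qed.

Lemma mulmx_diff i (v : 'rV_#|tbasis i.+1|) l :
  (v *m fc_diff truncated_taylor i) 0 l = taylor (chain_of v) (enum_val l).
Proof.
by rewrite mxE -tcoef_sum; apply: eq_bigr => k _; rewrite mxE.
Qed.

Lemma sgn_set0 j : sgn j set0 = 1 :> R.
Proof.
rewrite /sgn (_ : [set k in set0 | _] = set0) ?cards0 ?expr0 //.
by apply/setP => k; rewrite !inE.
Qed.

Lemma taylor_set0 u : taylor u set0 = \sum_j u [set j] * 'X_[g j].
Proof.
apply: eq_big => [j|j _]; first by rewrite inE.
by rewrite /taylor_weight setU0 lcm_exp1 lcm_exp0 subm0 mulrC sgn_set0 mul1r.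
Qed.

Lemma setU1_notin_tbasis i j tau :
  j \notin tau -> tau \notin tbasis i -> j |: tau \notin tbasis i.+1.
Proof.
move=> jt; apply: contra; rewrite !inE cardsU1 jt add1n eqSS => /andP[-> /=].
by case/orP => [/ltnW ->//|/andP[/eqP <- _]]; rewrite ltnSn.
Qed.

Lemma taylor_in_tbasis i u : in_tbasis i.+1 u -> in_tbasis i (taylor u).
Proof.
by move=> ui tau ti; apply: big1 => j jt;
  rewrite ui ?mulr0 // setU1_notin_tbasis.
Qed.

Lemma tbasis0 tau j : j \notin tau -> tau != set0 -> j |: tau \notin tbasis 0.
Proof.
by move=> jt t0; rewrite inE cardsU1 jt add1n eqSS cards_eq0 (negPf t0).
Qed.

Lemma taylor_in_tbasis0 u tau :
  in_tbasis 0 u -> tau != set0 -> taylor u tau = 0.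
Proof.
by move=> u0 t0; apply: big1 => j jt; rewrite u0 ?mulr0 // tbasis0.
Qed.

Hypothesis p_gt0 : (0 < p)%N.

Lemma tbasis0_set1 k : exists j, enum_val (k : 'I_#|tbasis 0|) = [set j].
Proof.
by have := enum_valP k; rewrite inE => /andP[/cards1P[j ->] _]; exists j.
Qed.

Lemma mulmx_aug (v : 'rV_#|tbasis 0|) :
  (v *m fc_aug truncated_taylor) 0 0 = taylor (chain_of v) set0.
Proof.
rewrite mxE -tcoef_sum; apply: eq_bigr => k _; rewrite mxE; congr (_ * _).
have [j ->] := tbasis0_set1 k.
rewrite /tcoef (eq_bigl (pred1 j)) => [|l]; last first.
  by rewrite inE setU0 (inj_eq set1_inj).
by rewrite big_pred1_eq sgn_set0 mul1r /taylor_weight setU0 lcm_exp0 subm0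
  lcm_exp1.
Qed.

Hypothesis lcm_sat : forall sigma tau,
  (p < #|sigma|)%N -> (p < #|tau|)%N -> lcm_exp sigma = lcm_exp tau.

Lemma truncated_taylor_exact i u : in_tbasis i u -> taylor u =1 (fun _ => 0) ->
  exists2 w, in_tbasis i.+1 w & taylor w =1 u.
Proof.
move=> ui u0; have usz : in_size i.+1 u.
  by move=> sigma si; rewrite ui // inE (negPf si).
have [pi|ip] := leqP p i.
  exists (fun _ => 0) => // tau; rewrite /taylor /bd big1 => [|j _]; last first.
    by rewrite mulr0.
  have [|/ui -> //] := boolP (tau \in tbasis i).
  rewrite inE ltnNge pi /= => /and3P[_ _ zt].
  (* Here i = p and z lies in tau. Any other index added to [tau :\ z] gives a set without z, where
     u vanishes; so the boundary there is u tau times a sign and a monomial. *)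
  have := u0 (tau :\ z); rewrite /taylor /bd (bigD1 z) /=;
    last by rewrite !inE eqxx.
  rewrite setD1K // big1 ?addr0 => [|j /andP[_ jz]]; last first.
    by rewrite ui ?mulr0 // !inE ltnNge pi eqxx [z == j]eq_sym (negPf jz)
      !andbF.
  move/(congr1 ( *%R (sgn z (tau :\ z)))); rewrite mulr0 !mulrA sgnK mul1r.
  move/eqP; rewrite mulf_eq0 => /orP[/eqP X0|/eqP -> //].
  have := congr1 (mcoeff (lcm_exp (z |: tau :\ z) - lcm_exp (tau :\ z))) X0.
  by rewrite mcoeffX eqxx mcoeff0 => /eqP; rewrite oner_eq0.
have [w wsz wu] := taylor_exact (ltn0Sn i) usz u0.
have [ip'|] := ltnP i.+1 p.
  by exists w => // sigma; rewrite inE ip' andbT => /wsz.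
move=> pi; have pE : p = i.+1 by apply/eqP; rewrite eqn_leq pi.
(* Subtracting a boundary keeps [taylor w]. If sigma has size p+1 and misses z, saturation gives
   adding z weight 1, so the subtracted value is w sigma. *)
exists (fun sigma => w sigma - taylor (cone z w) sigma); last first.
  by move=> tau; rewrite taylorB wu taylor_taylor subr0.
move=> sigma; rewrite inE pE ltnn eqxx /= negb_and.
have [sz /= zs|sz _] := eqVneq #|sigma| i.+2; last first.
  by rewrite wsz // (taylor_in_size g (cone_in_size z wsz)) // subr0.
rewrite /taylor bd_cone_notin // /taylor_weight (lcm_sat (tau := sigma)).
- by rewrite (_ : _ - _ = 0)%MM ?mpolyX0 ?mul1r ?subrr //; apply/mnmP => k;
    rewrite mnmBE subnn mnm0E.
- by rewrite cardsU1 zs sz pE add1n.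
- by rewrite sz pE.
Qed.

Hypothesis lcm_strict : forall tau j,
  (#|tau| <= p)%N -> j \notin tau -> lcm_exp (j |: tau) != lcm_exp tau.

Lemma mcoeff_tcoef sigma tau a :
  (tcoef sigma tau)@_a != 0 ->
  exists j, [/\ j \notin tau, j |: tau = sigma &
    a = (lcm_exp sigma - lcm_exp tau)%MM].
Proof.
rewrite raddf_sum /= => nz.
have [j /andP[/andP[jt /eqP js] ca] | no] := pickP (fun j =>
    [&& (j \notin tau) && (j |: tau == sigma) &
    (sgn j tau * taylor_weight K g j tau)@_a != 0]); last first.
  case/eqP: nz; apply: big1 => j jP; apply/eqP.
  by have := no j; rewrite jP => /negbFE.
exists j; split=> //; move: ca; rewrite mcoeff_sgnM /taylor_weight mcoeffX js.
by case: (_ =P a) => [-> //|_]; rewrite mulr0 eqxx.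
Qed.

Lemma truncated_taylor_resolution :
  minimal_graded_free_resolution (monomial_ideal g) truncated_taylor.
Proof.
have exact i (v : 'rV_#|tbasis i|) : taylor (chain_of v) =1 (fun _ => 0) ->
    exists x, v = x *m fc_diff truncated_taylor i.
  case/(truncated_taylor_exact (@chain_of_in i v)) => w wi wv.
  exists (\row_k w (enum_val k)); apply/rowP => l.
  rewrite mulmx_diff -(chain_of_enum_val v) -wv.
  by apply: eq_taylor => sigma; rewrite chain_of_row.
have chain_mul i (w : 'rV_#|tbasis i.+1|) :
    chain_of (w *m fc_diff truncated_taylor i) =1 taylor (chain_of w).
  move=> sigma; have tw := taylor_in_tbasis (@chain_of_in _ w).
  rewrite -(chain_of_row tw); congr (chain_of _ _).
  by apply/rowP => l; rewrite mulmx_diff mxE.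
split=> /=.
- by move=> k u; rewrite mxE msuppX inE => /eqP ->.
- move=> i k l u; rewrite mxE mcoeff_msupp => /mcoeff_tcoef[j [_ js ->]].
  have le : (lcm_exp (enum_val l) <= lcm_exp (enum_val k))%MM.
    by apply: lcm_exp_subset; rewrite -js subsetU1.
  by rewrite -mdegD submK.
- move=> f; split=> [[c fE]|[v vE]].
    (* Place c j on the singleton of j; the augmentation is the Taylor differential into the empty
       set. *)
    pose u sigma : R := \sum_(j | [set j] == sigma) c j.
    have u0 : in_tbasis 0 u.
      move=> sigma s0; apply: big1 => j /eqP js; case/negP: s0.
      by rewrite -js inE cards1 p_gt0.
    exists (\row_k u (enum_val k)); apply/matrixP => k l; rewrite !ord1.
    rewrite mulmx_aug mxE eqxx mulr1n (eq_taylor g (chain_of_row u0)).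
    rewrite taylor_set0 fE; apply: eq_bigr => j _; congr (_ * _).
    rewrite /u (eq_bigl (pred1 j)) ?big_pred1_eq // => l' /=.
    by rewrite (inj_eq set1_inj).
  exists (fun j => chain_of v [set j]); rewrite -taylor_set0 -mulmx_aug vE.
  by rewrite mxE eqxx mulr1n.
- move=> v; split=> [v0|[w ->]].
    apply: exact => tau; have [->|t0] := eqVneq tau set0.
      by rewrite -mulmx_aug v0 mxE.
    exact: taylor_in_tbasis0 (@chain_of_in _ v) t0.
  apply/matrixP => k l;
    rewrite !ord1 mulmx_aug mxE (eq_taylor g (chain_mul _ w)).
  exact: taylor_taylor.
- move=> i v; split=> [v0|[w ->]].
    apply: exact => tau; have [ti|ti] := boolP (tau \in tbasis i).
      by rewrite -(enum_rankK_in ti ti) -mulmx_diff v0 mxE.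
    exact: taylor_in_tbasis (@chain_of_in _ v) _ ti.
  apply/rowP => l; rewrite mulmx_diff mxE (eq_taylor g (chain_mul _ w)).
  exact: taylor_taylor.
(* A nonzero constant term would make two consecutive lcms equal, although the smaller set has at
   most p elements. *)
move=> i k l; rewrite mxE; apply/eqP/negPn/negP => /mcoeff_tcoef[j [jt js aE]].
have := enum_valP k; rewrite -js inE cardsU1 jt add1n eqSS => /andP[/eqP tc ip].
have /lcm_strict/(_ jt)/eqP[] : (#|enum_val l| <= p)%N.
  by rewrite tc; case/orP: ip => [/ltnW|/andP[/eqP->]].
have le := lcm_exp_subset g (subsetU1 j (enum_val l)).
by rewrite js in le *; rewrite -(submK le) -aE add0m.
Qed.

End TruncatedTaylor.

(** * Counting subsets *)

Lemma exists_card_between (T : finType) (A B : {set T}) k :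
    A \subset B -> (#|A| <= k <= #|B|)%N ->
  exists S : {set T}, [/\ A \subset S, S \subset B & #|S| = k].
Proof.
move=> AB /andP[Ak kB].
have /card_gt0P[S] :
    (0 < #|[set S : {set T} | S \subset B :\: A & #|S| == k - #|A|]|)%N.
  by rewrite cards_draws bin_gt0 cardsD (setIidPr AB) leq_sub2r.
rewrite inE => /andP[SB /eqP Sk]; exists (A :|: S); split.
- exact: subsetUl.
- by rewrite subUset AB (subset_trans SB) // subsetDl.
rewrite cardsU Sk (_ : A :&: S = set0) ?cards0 ?subn0 ?subnKC //.
apply/eqP; rewrite setI_eq0 disjoint_sym; apply: disjointWl SB _.
by rewrite -setI_eq0 setIDAC setDIl setDv setI0.
Qed.

(** Complementation turns the supersets of size k into subsets of size n - k of the complement of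
    sigma. *)
Lemma sum_supsets n (F : nat -> nat) (sigma : {set 'I_n}) :
  (\sum_(S : {set 'I_n} | sigma \subset S) F #|S|
    = \sum_(k < n.+1) 'C(n - #|sigma|, n - k) * F k)%N.
Proof.
have le_n (S : {set 'I_n}) : (#|S| < n.+1)%N.
  by rewrite ltnS -[leqRHS]card_ord max_card.
rewrite (partition_big (fun S => Ordinal (le_n S)) xpredT) //=.
apply: eq_bigr => k _; rewrite (eq_bigr (fun _ => F k)); last first.
  by move=> S /andP[_ /eqP <-].
rewrite sum_nat_const; congr (_ * _)%N.
have -> : (n - #|sigma| = #|~: sigma|)%N.
  by rewrite [#|~: sigma|]cardsCs setCK card_ord.
rewrite -cards_draws -[RHS](card_imset _ (@setC_inj _)); apply: eq_card => S.
apply/idP/imsetP => [/andP[sS /eqP kE]|[A + ->]].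
  exists (~: S); last by rewrite setCK.
  by rewrite inE setCS sS cardsCs setCK card_ord -kE eqxx.
rewrite inE => /andP[As /eqP Ak]; apply/andP; split;
  first by rewrite -setCS setCK.
rewrite -val_eqE /= cardsCs setCK Ak card_ord subKn //.
by rewrite -ltnS.
Qed.

Lemma eq_sum_not_supsets n (F : nat -> nat) (sigma tau : {set 'I_n}) :
    #|sigma| = #|tau| ->
  (\sum_(S : {set 'I_n} | ~~ (sigma \subset S)) F #|S|
    = \sum_(S : {set 'I_n} | ~~ (tau \subset S)) F #|S|)%N.
Proof.
move=> st; have tot rho : (\sum_(S : {set 'I_n} | rho \subset S) F #|S|
    + \sum_(S : {set 'I_n} | ~~ (rho \subset S)) F #|S|
    = \sum_(S : {set 'I_n}) F #|S|)%N.
  by rewrite [RHS](bigID (fun S : {set 'I_n} => rho \subset S)).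
apply: (@addnI (\sum_(S : {set 'I_n} | sigma \subset S) F #|S|)%N).
by rewrite tot sum_supsets st -sum_supsets tot.
Qed.

Lemma card_tbasis n p (z : 'I_n) i : (i <= p)%N ->
  #|tbasis p z i| = if (i < p)%N then 'C(n, i.+1) else 'C(n.-1, p).
Proof.
move=> ip; case: ifP => [lt|/negbT]; last rewrite -leqNgt => pi.
  by rewrite -[n in RHS]card_ord -card_draws; apply: eq_card => S;
    rewrite !inE lt andbT.
have {ip pi} -> : i = p by apply/eqP; rewrite eqn_leq ip.
have -> : n.-1 = #|~: [set z]| by rewrite cardsCs setCK cards1 card_ord subn1.
(* For i = p, adding z matches the p-subsets avoiding z with the sets of [tbasis]. *)
rewrite -cards_draws -[RHS](@card_in_imset _ _ (fun A => z |: A)); last first.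
  move=> A A'; rewrite !inE => /andP[Az _] /andP[A'z _]
    /(congr1 (fun B => B :\ z)).
  by rewrite !setU1K //;
    [rewrite subsetC sub1set inE in A'z|rewrite subsetC sub1set inE in Az].
apply: eq_card => S; rewrite inE ltnn eqxx /=;
  apply/andP/imsetP => [[/eqP Sp zS]|[A + ->]].
  exists (S :\ z); last by rewrite setD1K.
  rewrite inE subsetC sub1set !inE eqxx /=.
  by move: Sp; rewrite (cardsD1 z) zS add1n => -[->].
rewrite inE subsetC sub1set inE => /andP[zA /eqP Ap].
by rewrite cardsU1 zA Ap add1n setU11.
Qed.

(** * Squarefree monomials and monomial ideals *)

Lemma face_monomialE (K : fieldType) (V : finType) (F : {set V}) :
  face_monomial K F = 'X_[ [multinom (enum_val i \in F : nat) | i < #|V|] ].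
Proof.
rewrite /face_monomial mprodXE; congr 'X_[_]; apply/mnmP => i.
rewrite mnm_sumE mnmE.
under eq_bigr => v _ do rewrite mnm1E -(inj_eq enum_val_inj) enum_rankK.
have [iF|iF] := boolP (enum_val i \in F).
  rewrite (bigD1 (enum_val i)) //= eqxx big1 ?addn0 // => v /andP[_ /negPf ->]
    //.
by rewrite big1 // => v vF; case: eqP => // vi; rewrite -vi vF in iF.
Qed.

Section MonomialIdeal.

Variables (K : fieldType) (n N : nat) (g : 'I_n -> 'X_{1..N}).
Local Notation R := {mpoly K[N]}.

Lemma monomial_ideal0 : monomial_ideal g (0 : R).
Proof. by exists (fun _ => 0); rewrite big1 // => j _; rewrite mul0r. Qed.

Lemma monomial_idealD (f h : R) :
  monomial_ideal g f -> monomial_ideal g h -> monomial_ideal g (f + h).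
Proof.
move=> [c ->] [d ->]; exists (fun j => c j + d j).
by rewrite -big_split; apply: eq_bigr => j _; rewrite mulrDl.
Qed.

Lemma monomial_idealMX (f : R) j a :
  (g j <= a)%MM -> monomial_ideal g (f * 'X_[a]).
Proof.
move=> le; exists (fun l => if l == j then f * 'X_[a - g j] else 0).
rewrite (bigD1 j) //= eqxx big1 => [|l /negPf->]; last by rewrite mul0r.
by rewrite addr0 -mulrA -mpolyXD submK.
Qed.

End MonomialIdeal.

Lemma eq_ideal_resolution (K : fieldType) N (I J : {mpoly K[N]} -> Prop) C :
    (forall f, I f <-> J f) ->
  minimal_graded_free_resolution I C -> minimal_graded_free_resolution J C.
Proof. by move=> IJ [? ? e ? ? ?]; split=> // f; rewrite -IJ e. Qed.

(** * The dual ideal of an intersection complex and its lcms *)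

Section IntersectionComplex.

Variables (K : fieldType) (n : nat) (m : n.-tuple nat).
Implicit Types sigma tau rho : {set 'I_n}.

Definition facet_exp (j : 'I_n) : 'X_{1..#|vertex m|} :=
  [multinom (enum_val i \notin facet m j : nat) | i < #|vertex m|].

Lemma lcm_facet_exp sigma i :
  lcm_exp facet_exp sigma i = ~~ (sigma \subset val (tag (enum_val i))).
Proof.
rewrite mnmE; have [sub|/subsetPn[j js jS]] := boolP (sigma \subset _).
  by apply/eqP; rewrite -leqn0; apply/bigmax_leqP => j /(subsetP sub) jS;
    rewrite mnmE inE jS.
apply/eqP; rewrite eqn_leq; apply/andP; split.
  by apply/bigmax_leqP => l _; rewrite mnmE leq_b1.
apply: leq_trans (@leq_bigmax_cond _ _ (fun l => facet_exp l i) j js).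
by rewrite mnmE inE jS.
Qed.

(** The nonfaces of the dual are exactly the sets containing the complement of some facet, so these
    complements generate. *)
Lemma SR_ideal_dual (f : {mpoly K[#|vertex m|]}) :
  SR_ideal (alexander_dual (intersection_complex m)) f <->
  monomial_ideal facet_exp f.
Proof.
have dualE (F : {set vertex m}) :
    F \notin alexander_dual (intersection_complex m)
    = [exists j, ~: F \subset facet m j] by rewrite !inE negbK.
have genE j : 'X_[facet_exp j] = face_monomial K (~: facet m j).
  rewrite face_monomialE; congr 'X_[_]; apply/mnmP => i.
  by rewrite !mnmE in_setC.
split=> [[a ->]|[c ->]].
  elim/big_ind: _ => [||F]; [exact: monomial_ideal0|exact: monomial_idealD|].
  rewrite dualE => /existsP[j Fj]; rewrite face_monomialE.
  apply: (@monomial_idealMX _ _ _ _ _ j); apply/mnm_lepP => i; rewrite !mnmE.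
  case: (boolP (_ \in facet m j)) => // nj.
  by have := contraNN (subsetP Fj (enum_val i)) nj; rewrite in_setC negbK => ->.
(* Different j may have the same facet, so their coefficients are added up. *)
exists (fun F => \sum_(j | ~: facet m j == F) c j).
rewrite (partition_big (fun j => ~: facet m j)
  (fun F => F \notin alexander_dual (intersection_complex m))) /=; last first.
  by move=> j _; rewrite dualE; apply/existsP; exists j; rewrite setCK.
apply: eq_bigr => F _; rewrite mulr_suml; apply: eq_bigr => j /eqP <-.
by rewrite genE.
Qed.

Lemma mdeg_lcm_facet_exp sigma :
  (mdeg (lcm_exp facet_exp sigma)
    = \sum_(S : {set 'I_n} | ~~ (sigma \subset S)) entry m #|S|)%N.
Proof.
rewrite mdegE; under eq_bigr => i _ do rewrite lcm_facet_exp.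
transitivity (\sum_(v : vertex m) ~~ (sigma \subset val (tag v)))%N.
  by rewrite [RHS](@big_enum_val _ _ _ _ (vertex m)); apply: eq_bigr.
rewrite -(sig_big_dep xpredT (fun _ _ => true)
  (fun (S : nonempty_subset n) (_ : 'I_(entry m #|val S|)) =>
    nat_of_bool (~~ (sigma \subset val S)))) /=.
transitivity (\sum_(S : nonempty_subset n)
    entry m #|val S| * ~~ (sigma \subset val S))%N.
  by apply: eq_bigr => S _; rewrite sum_nat_const card_ord.
rewrite -(big_sub [pred S : {set 'I_n} | S != set0]
  (fun S => entry m #|S| * ~~ (sigma \subset S))%N) /=.
rewrite big_mkcond [RHS]big_mkcond; apply: eq_bigr => S _.
(* The empty set indexes no vertex, and its summand is 0 because [entry m 0] is the leading 0. *)
rewrite inE; have [->|_] := eqVneq S set0; first by rewrite cards0 if_same.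
by case: ifP => _; rewrite ?muln1 ?muln0.
Qed.

Lemma entry_gt0_vertex (v : vertex m) : entry m #|val (tag v)| != 0%N.
Proof. by rewrite -lt0n; case: (tagged v) => r; apply: leq_ltn_trans. Qed.

Section MaximalIndex.

Variable p : nat.
Hypotheses (p_gt0 : (0 < p)%N) (p_lt_n : (p < n)%N) (p_nz : entry m p != 0%N).
Hypothesis p_ub : forall S : {set 'I_n}, entry m #|S| != 0%N -> (#|S| <= p)%N.

(** A vertex over S has |S| at most p, so S contains no set of more than p indices and every
    exponent is 1. *)
Lemma lcm_facet_exp_sat sigma tau : (p < #|sigma|)%N -> (p < #|tau|)%N ->
  lcm_exp facet_exp sigma = lcm_exp facet_exp tau.
Proof.
have sat rho i : (p < #|rho|)%N -> lcm_exp facet_exp rho i = 1%N.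
  move=> pr; rewrite lcm_facet_exp;
  case: (boolP (rho \subset _)) => // /subset_leq_card.
  by move/(leq_trans pr); rewrite ltnNge p_ub // entry_gt0_vertex.
by move=> ps pt; apply/mnmP => i; rewrite !sat.
Qed.

Lemma lcm_facet_exp_strict tau j : (#|tau| <= p)%N -> j \notin tau ->
  lcm_exp facet_exp (j |: tau) != lcm_exp facet_exp tau.
Proof.
move=> tp jt.
(* Since |tau| <= p <= n - 1, some p-set S contains tau and misses j. As m_p is nonzero, S carries a
   vertex, which divides only the larger lcm. *)
have [||S [tS Sj Sp]] := @exists_card_between _ tau (~: [set j]) p.
- by rewrite subsetC sub1set inE.
- by rewrite tp cardsCs setCK cards1 card_ord -ltnS subn1 prednK //
    (leq_ltn_trans _ p_lt_n).
have S0 : S != set0 by rewrite -card_gt0 Sp.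
have r0 : (0 < entry m #|S|)%N by rewrite Sp lt0n.
pose v : vertex m := Tagged (fun S : nonempty_subset n => 'I_(entry m #|val S|))
  (Ordinal r0 : 'I_(entry m #|val (exist _ S S0 : nonempty_subset n)|)).
apply/eqP => /mnmP/(_ (enum_rank v)); rewrite !lcm_facet_exp enum_rankK /=.
by rewrite subUset sub1set tS; move: Sj;
  rewrite subsetC sub1set inE => /negPf ->.
Qed.

End MaximalIndex.

End IntersectionComplex.

Close Scope ring_scope.

Theorem theorem3p12 (K : fieldType) (n : nat) (m : n.-tuple nat) (p : nat)
    (beta : nat -> nat -> nat) (c : nat -> nat)
    (m_nonzero : exists2 j : nat, 1 <= j <= n & entry m j != 0)
    (mn0 : entry m n = 0)
    (p_max : p = \max_(1 <= j < n.+1 | entry m j != 0) j)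
    (beta_betti :
      betti_diagram
        (SR_ideal (K := K) (alexander_dual (intersection_complex m))) beta)
    (beta_nonzero : forall i : nat, i <= p -> beta i (c i) <> 0)
    (i : nat) (i_le_p : i <= p) :
  beta i (c i) = if i < p then 'C(n, i.+1) else 'C(n.-1, p).
Proof.
have le_p j : (1 <= j <= n)%N -> entry m j != 0%N -> (j <= p)%N.
  move=> jn mj; rewrite p_max; apply: (@leq_bigmax_seq _ _ _ id) mj.
  by rewrite mem_index_iota ltnS.
have p_gt0 : (0 < p)%N.
  by case: m_nonzero => j jn mj; apply: leq_trans (le_p _ jn mj); case/andP: jn.
have [p_nz p_le_n] : entry m p != 0%N /\ (p <= n)%N.
  (* The first alternative is the value of an empty maximum, excluded by [p_gt0]. *)
  have : p = 0%N \/ entry m p != 0%N /\ (p <= n)%N.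
    rewrite p_max big_nat_cond.
    elim/big_ind: _ => [|x y Px Py|j /andP[/andP[_ jn] mj]]; first by left.
      by rewrite /maxn; case: ifP.
    by right.
  by case=> // p0; rewrite p0 in p_gt0.
have p_lt_n : (p < n)%N.
  rewrite ltn_neqAle p_le_n andbT; apply: contraNneq p_nz => ->; exact/eqP.
have p_ub (S : {set 'I_n}) : entry m #|S| != 0%N -> (#|S| <= p)%N.
  move=> mS; have := max_card S; rewrite card_ord => Sn.
  apply: le_p => //; rewrite Sn andbT lt0n.
  by apply: contraNneq mS => ->.
pose z := Ordinal (leq_ltn_trans (leq0n p) p_lt_n).
have resT := @truncated_taylor_resolution K _ _ p z _ p_gt0
  (lcm_facet_exp_sat p_ub) (lcm_facet_exp_strict p_gt0 p_lt_n p_nz).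
case: beta_betti => C /(eq_ideal_resolution (@SR_ideal_dual K n m)) resC betaE.
have := beta_nonzero i i_le_p.
rewrite betaE (betti_unique i (c i) resC resT) -(card_tbasis z i_le_p).
(* A nonzero Betti number supplies one basis element of degree c i. All basis elements in position i
   have equal size, hence this same degree, so the whole basis is counted. *)
move/eqP; rewrite -lt0n => /card_gt0P[k0]; rewrite inE /= => /eqP dk0.
transitivity #|[set: 'I_#|tbasis p z i|]|; last by rewrite cardsT card_ord.
apply: eq_card => k; rewrite !inE /= -dk0 !mdeg_lcm_facet_exp; apply/eqP.
apply: eq_sum_not_supsets.
have := enum_valP k; have := enum_valP k0; rewrite !inE.
by move=> /andP[/eqP -> _] /andP[/eqP -> _].
Qed.
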